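(* The probability of absorption in an MFB is $1$: $$\sum_{k=-\infty}^{\infty}s_0\,x_{kN}=1.$$
   Context: Setting. Let $N>1$ be an integer. Consider a discrete-time random walk on $\mathbb Z$ with a multiple function barrier (MFB) at every point $kN$, $k\in\mathbb Z$. At each time step, a walker located at an MFB $kN$ moves to $kN+1$ with probability $p_0$, moves to $kN-1$ with probability $q_0$, stays in $kN$ with probability $r_0$, and is absorbed in that MFB (the walk ends) with probability $s_0$, where $p_0+q_0+r_0+s_0=1$, $r_0\ge 0$ and $p_0q_0s_0>0$. A walker located at a point that is not a multiple of $N$ moves one step forward ($+1$) with probability $p$, one step backward ($-1$) with probability $q$, and stays with probability $r=1-p-q\ge 0$, where $pq>0$. The walk starts in $i_0$, an integer with $0\le i_0<N$. Notation. $x_j=\sum_{m=0}^{\infty}p_{i_0j}^{(m)}$ is the expected number of arrivals in state $j$, where $p_{ij}^{(m)}$ is the probability that the walker started in $i$ is at $j$ after $m$ steps, not yet absorbed (time $0$ is counted). *)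

(* Defs.v *)
From HB Require Import structures.
From mathcomp Require Import all_boot all_order all_algebra.
From mathcomp Require Import all_classical all_reals all_analysis.

Set Implicit Arguments.
Unset Strict Implicit.
Unset Printing Implicit Defensive.
Import Order.TTheory GRing.Theory Num.Theory.

Local Open Scope classical_set_scope.
Local Open Scope ring_scope.

(* [inl j]: the walker is at [j] and not yet absorbed; [inr j]: the walk has
   ended by absorption in [j]. *)
Definition state : Type := (int + int)%type.

(* One-step transition probabilities; [inr j] is a trap. *)
Definition step_prob (R : realType) (N : nat) (p0 q0 r0 s0 p q : R)
    (a b : state) : R :=
  match a, b with
  | inl i, inl j =>
      let: (up, down, stay) :=
        if (N%:Z %| i)%Z then (p0, q0, r0) else (p, q, 1 - p - q) in
      if j == i + 1 then up
      else if j == i - 1 then down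
      else if j == i then stay
      else 0
  | inl i, inr j => if (N%:Z %| i)%Z && (j == i) then s0 else 0
  | inr _, inl _ => 0
  | inr i, inr j => if j == i then 1 else 0
  end.

(* [X] is a realization of the walk started in [i0].  The Markov property is
   conditioned on the whole past, in product form so that histories of
   probability zero need no separate treatment. *)
Record mfb_walk (R : realType) (N : nat) (p0 q0 r0 s0 p q : R) (i0 : int)
    (d : measure_display) (T : measurableType d) (P : probability T R)
    (X : nat -> T -> state) : Prop := MfbWalk {
  mfb_measurable : forall m a, measurable (X m @^-1` [set a]);
  mfb_start : P (X 0%N @^-1` [set inl i0]) = 1%E;
  mfb_step : forall (m : nat) (h : nat -> state),
    P [set w | forall l, (l <= m.+1)%N -> X l w = h l] =
    (P [set w | forall l, (l <= m)%N -> X l w = h l] *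
     (step_prob N p0 q0 r0 s0 p q (h m) (h m.+1))%:E)%E
}.

Definition expected_arrivals (R : realType) (d : measure_display)
    (T : measurableType d) (P : probability T R) (X : nat -> T -> state)
    (j : int) : \bar R :=
  (\sum_(0 <= m <oo) P (X m @^-1` [set inl j]))%E.

Definition absorbed_in_mfb (N : nat) (T : Type) (X : nat -> T -> state) :
    set T :=
  [set w | exists (m : nat) (k : int), X m w = inr (k * N%:Z)].

(* Main.v *)
(* The probability S_n that the walk is alive at time n tends to 0 by a drift
   argument.  Put eta = q / 2 and V(i) = M - eta ^ (i mod N) on live states, 0 on
   absorbed ones.  Off the barriers V drops in mean by a fixed c > 0, since a
   step down divides eta ^ (i mod N) by eta and a step up multiplies it by at
   least eta; on the barriers the absorption makes V drop as soon as s0 * M is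
   1 + c.  Hence c * (S_0 + ... + S_(n-1)) <= V(i0) for all n.  On the other hand
   S_n - S_(n+1) is s0 times the probability of standing on a barrier at time
   n, so that the partial sums of the absorption series are 1 - S_n. *)
Require Import Defs.
From HB Require Import structures.
From mathcomp Require Import all_boot all_order all_algebra.
From mathcomp Require Import all_classical all_reals all_analysis.
From mathcomp Require Import ring lra zify.

Set Implicit Arguments.
Unset Strict Implicit.
Unset Printing Implicit Defensive.
Import Order.TTheory GRing.Theory Num.Theory.

Local Open Scope classical_set_scope.
Local Open Scope ring_scope.

(** * Sums of nonnegative terms over arbitrary index sets, and countable additivity *)

Lemma esumZl (R : realType) (I : choiceType) (S : set I) (c : R)
    (a : I -> \bar R) : 0 <= c -> (forall i, 0 <= a i)%E ->
  (\esum_(i in S) (c%:E * a i) = c%:E * \esum_(i in S) a i)%E.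
Proof.
move=> c0 a0; rewrite /esum -ereal_supZl //; last first.
  apply/set0P; exists (\sum_(i \in set0) a i)%E; exists set0 => //.
  exact: fsets_set0.
congr ereal_sup; apply/seteqP; split => x /=.
  move=> [A fA <-]; exists (\sum_(i \in A) a i)%E; first by exists A.
  by rewrite ge0_mule_fsumr.
by move=> [_ [A fA <-] <-]; exists A => //; rewrite ge0_mule_fsumr.
Qed.

Lemma exchange_esum (R : realType) (I J : choiceType) (a : I -> J -> \bar R) :
  (forall i j, 0 <= a i j)%E ->
  (\esum_(i in [set: I]) \esum_(j in [set: J]) a i j =
   \esum_(j in [set: J]) \esum_(i in [set: I]) a i j)%E.
Proof.
move=> a0; rewrite !esum_esum//.
pose swap (k : I * J) : J * I := (k.2, k.1).
rewrite [RHS](@reindex_esum _ _ _ ([set: I] `*`` fun=> [set: J])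
  ([set: J] `*`` fun=> [set: I]) swap)//.
by split=> //= [[? ?] [? ?] _ _ [-> ->]//|[j i] _]; exists (i, j).
Qed.

(** Countable additivity over [nat], carried to [C] by [pickle]; numbers that code no element get
    the empty set. *)
Lemma measure_bigcup_esum (R : realType) (C : countType)
    (d : measure_display) (T : measurableType d) (mu : {measure set T -> \bar R})
    (F : C -> set T) : (forall c, measurable (F c)) -> trivIset setT F ->
  (mu (\bigcup_c F c) = \esum_(c in [set: C]) mu (F c))%E.
Proof.
move=> mF tF; pose G n := if pickle_inv n is Some c then F c else set0 : set T.
have GE c : G (pickle c) = F c by rewrite /G pickleK_inv.
have -> : \bigcup_c F c = \bigcup_n G n.
  apply/seteqP; split => x [].
    by move=> c _ Fx; exists (pickle c) => //; rewrite GE.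
  by move=> n _; rewrite /G; case: pickle_inv => // c Fx; exists c.
rewrite measure_bigcup//; last 2 first.
- by move=> n _; rewrite /G; case: pickle_inv.
- move=> m n _ _; rewrite /G.
  case Em: (@pickle_inv C m) => [b|]; last by rewrite set0I => /set0P; rewrite eqxx.
  case En: (@pickle_inv C n) => [c|]; last by rewrite setI0 => /set0P; rewrite eqxx.
  move=> /(tF _ _ I I) bc.
  have := @pickle_invK C m; have := @pickle_invK C n.
  by rewrite Em En /= bc => -> ->.
rewrite (eq_eseriesl (Q := xpredT)); last by move=> n; rewrite in_setT.
rewrite nneseries_esumT; last by move=> n; exact: measure_ge0.
rewrite [RHS](eq_esum (b := fun c => mu (G (pickle c)))); last by move=> c _; rewrite GE.
rewrite -(@esum_image _ _ _ setT (@pickle C) (fun n => mu (G n))); last first.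
  by move=> x y _ _; exact: (pcan_inj pickleK_inv).
rewrite [RHS]esum_mkcond. apply: eq_esum => n _.
case: ifPn => //; rewrite notin_setE => /= nim.
rewrite /G; have := @pickle_invK C n; case: pickle_inv => [c /= cn|_].
  by exfalso; apply: nim; exists c.
by rewrite measure0.
Qed.
(** Measurability is assumed for points only; countability of [C] extends it to every set of
    states. *)
Lemma preimage_countable_measurable (C : countType) (d : measure_display)
    (T : measurableType d) (Y : T -> C) (D : set C) :
  (forall c, measurable (Y @^-1` [set c])) -> measurable (Y @^-1` D).
Proof.
move=> mY.
have -> : Y @^-1` D = \bigcup_(c in D) (Y @^-1` [set c]).
  apply/seteqP; split => [w Dw|w [c Dc /= Yw]]; first by exists (Y w).
  by rewrite /= Yw.
rewrite bigcup_mkcond; apply: countable_bigcupT_measurable.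
  exact: countableP.
by move=> c; case: ifP.
Qed.

Lemma probability_total (R : realType) (C : countType) (d : measure_display)
    (T : measurableType d) (P : probability T R) (Y : T -> C)
    (A : set T) : measurable A -> (forall c, measurable (Y @^-1` [set c])) ->
  (P A = \esum_(c in [set: C]) P (A `&` Y @^-1` [set c]))%E.
Proof.
move=> mA mY; rewrite -measure_bigcup_esum.
- congr (P _); apply/seteqP; split => [w Aw|w [c _ []]//].
  by exists (Y w).
- by move=> c; exact: measurableI.
- by move=> a b _ _ [w [[_ <-] [_ <-]]].
Qed.

(** * Markov chains on a countable state space *)

Section countable_markov_chain.
Context (R : realType) (C : countType) (d : measure_display)
  (T : measurableType d) (P : probability T R) (X : nat -> T -> C)
  (K : C -> C -> R).
Context (mX : forall m a, measurable (X m @^-1` [set a])).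
Context (K_ge0 : forall a b, 0 <= K a b).
Context (XK : forall m (h : nat -> C),
  P [set w | forall l, (l <= m.+1)%N -> X l w = h l] =
  (P [set w | forall l, (l <= m)%N -> X l w = h l] *
   (K (h m) (h m.+1))%:E)%E).

(** Histories are coded as elements of the countable type [seq C], so that total probability applies
    to them. Only the times before [n] are recorded. *)
Let path n w : seq C := mkseq (X ^~ w) n.

Let path_historyE m h : path m.+1 @^-1` [set mkseq h m.+1] =
  [set w | forall l, (l <= m)%N -> X l w = h l].
Proof.
apply/seteqP; split => w /=.
  move=> e l lm; have := congr1 (nth (h 0%N) ^~ l) e.
  by rewrite !nth_mkseq.
move=> e; apply: (@eq_from_nth _ (h 0%N)); rewrite !size_mkseq// => l lm.
by rewrite !nth_mkseq// e.
Qed.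

Let measurable_path n s : measurable (path n @^-1` [set s]).
Proof.
elim: n s => [|n IH] s.
  have [->|s0] := eqVneq s [::].
    rewrite [X in measurable X](_ : _ = setT)//.
    by apply/seteqP; split.
  rewrite [X in measurable X](_ : _ = set0)//.
  apply/seteqP; split => // w /= e.
  by rewrite -e eqxx in s0.
case/lastP: s => [|s a].
  rewrite [X in measurable X](_ : _ = set0)//.
  by apply/seteqP; split => // w /= /(congr1 size); rewrite size_mkseq.
rewrite [X in measurable X](_ : _ = path n @^-1` [set s] `&` X n @^-1` [set a]).
  exact: measurableI.
apply/seteqP; split => w; rewrite /= /path mkseqS; last by move=> [-> ->].
by move=> /eqP; rewrite eqseq_rcons => /andP[/eqP -> /eqP ->].
Qed.

(** Splitting both sides by [path m], the history strictly before time [m], leaves single histories,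
    to which [XK] applies term by term. *)
Lemma chain_joint m a b :
  P (X m @^-1` [set a] `&` X m.+1 @^-1` [set b]) =
  (P (X m @^-1` [set a]) * (K a b)%:E)%E.
Proof.
rewrite (@probability_total _ _ _ _ P (path m)) //; last exact: measurableI.
rewrite [in RHS](@probability_total _ _ _ _ P (path m)) //.
rewrite muleC -esumZl//; apply: eq_esum => s _.
(* Sequences of the wrong length are no history and contribute nothing. *)
have [sm|sm] := eqVneq (size s) m; last first.
  have -> : path m @^-1` [set s] = set0.
    apply/seteqP; split => // w /= e.
    by rewrite -e size_mkseq eqxx in sm.
  by rewrite !setI0 measure0 mule0.
(* [XK] takes a history on all of [nat]; the default [a] only fills the times after [m.+1], which
   the events ignore. *)
pose h := nth a (rcons (rcons s a) b).
have hm : h m = a.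
  by rewrite /h !nth_rcons size_rcons sm leqnn ltnn eqxx.
have hm1 : h m.+1 = b.
  by rewrite /h !nth_rcons size_rcons sm ltnn eqxx.
have hs : mkseq h m = s.
  apply: (@eq_from_nth _ a); rewrite size_mkseq// => l lm.
  by rewrite nth_mkseq// /h !nth_rcons size_rcons sm lm ltnS ltnW.
have := XK m h; rewrite hm hm1 -!path_historyE !(mkseqS h) hs hm hm1.
rewrite muleC => e.
rewrite [X in (_ = _ * P X)%E](_ : _ = path m.+1 @^-1` [set rcons s a]).
  rewrite -e; congr (P _); apply/seteqP; split => w /=; rewrite /path !mkseqS.
    by move=> [[-> ->] ->].
  by move=> /eqP; rewrite !eqseq_rcons => /andP[/andP[/eqP -> /eqP ->] /eqP ->].
apply/seteqP; split => w /=; rewrite /path mkseqS.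
  by move=> [-> ->].
by move=> /eqP; rewrite eqseq_rcons => /andP[/eqP -> /eqP ->].
Qed.

Definition chain_mean m (f : C -> R) : \bar R :=
  (\esum_(a in [set: C]) (P (X m @^-1` [set a]) * (f a)%:E))%E.

Lemma chain_mean_ge0 m f : (forall a, 0 <= f a) -> (0 <= chain_mean m f)%E.
Proof. by move=> f0; apply: esum_ge0 => a _; rewrite mule_ge0// lee_fin. Qed.

Lemma chain_meanZ m (c : R) (f : C -> R) : 0 <= c -> (forall a, 0 <= f a) ->
  (chain_mean m (fun a => (c * f a)%R) = c%:E * chain_mean m f)%E.
Proof.
move=> c0 f0; rewrite -esumZl//; last by move=> a; rewrite mule_ge0// lee_fin.
by apply: eq_esum => a _; rewrite EFinM muleCA.
Qed.

Lemma chain_mean_indic m (D : set C) :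
  P (X m @^-1` D) = chain_mean m (\1_D).
Proof.
rewrite (@probability_total _ _ _ _ P (X m) _ _ (mX m)); last first.
  exact: preimage_countable_measurable.
apply: eq_esum => a _; rewrite indicE; have [|] := boolP (a \in D).
  rewrite inE mule1 => Da; congr (P _); apply/seteqP.
  by split => [w []//|w /= Xw]; rewrite /= Xw.
rewrite notin_setE mule0 => nDa.
have -> : X m @^-1` D `&` X m @^-1` [set a] = set0.
  by apply/seteqP; split => // w /= [] /[swap] ->.
exact: measure0.
Qed.

(** The start carries all the mass; additivity and the bound 1 leave none for any other state. *)
Lemma chain_mean0 a0 f : P (X 0%N @^-1` [set a0]) = 1%E ->
  (forall a, 0 <= f a) -> chain_mean 0 f = (f a0)%:E.
Proof.
move=> Xa0 f0.
have Xa a : a != a0 -> P (X 0%N @^-1` [set a]) = 0%E.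
  move=> aa0; have : (P (X 0%N @^-1` [set a] `|` X 0%N @^-1` [set a0]) <= 1)%E.
    by apply: probability_le1; exact: measurableU.
  have -> : P (X 0%N @^-1` [set a] `|` X 0%N @^-1` [set a0]) =
      (P (X 0%N @^-1` [set a]) + P (X 0%N @^-1` [set a0]))%E.
    apply: measureU => //; apply/seteqP; split => // w /= [-> e].
    by rewrite e eqxx in aa0.
  rewrite -[X in (_ <= X)%E]add0e Xa0 leeD2rE// => le0.
  by apply/eqP; rewrite eq_le le0 measure_ge0.
rewrite -[RHS]mul1e -Xa0 -(@esum_set1 _ _ a0 (fun a =>
  (P (X 0%N @^-1` [set a]) * (f a)%:E)%E)); last by rewrite mule_ge0// lee_fin.
rewrite [RHS]esum_mkcond; apply: eq_esum => a _.
have [->|/Xa ->] := eqVneq a a0; first by rewrite mem_set.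
by rewrite mul0e if_same.
Qed.

(** Chapman-Kolmogorov: [chain_joint] followed by Tonelli. *)
Lemma chain_meanS m f : (forall a, 0 <= f a) ->
  chain_mean m.+1 f = (\esum_(a in [set: C])
    (P (X m @^-1` [set a]) * \esum_(b in [set: C]) (K a b * f b)%:E))%E.
Proof.
move=> f0.
transitivity (\esum_(b in [set: C]) \esum_(a in [set: C])
    (P (X m @^-1` [set a]) * (K a b * f b)%:E))%E.
  apply: eq_esum => b _; rewrite (@probability_total _ _ _ _ P (X m)) //.
  rewrite muleC -esumZl//; apply: eq_esum => a _.
  by rewrite setIC chain_joint EFinM muleC -muleA.
rewrite exchange_esum; last by move=> a b; rewrite mule_ge0// lee_fin mulr_ge0.
apply: eq_esum => a _.
rewrite -[P _]fineK ?fin_num_measure// esumZl ?fine_ge0//.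
by move=> b; rewrite lee_fin mulr_ge0.
Qed.

Lemma chain_mean_drift m f g : (forall a, 0 <= f a) -> (forall a, 0 <= g a) ->
  (chain_mean m.+1 f + chain_mean m g = \esum_(a in [set: C])
    (P (X m @^-1` [set a]) *
     (\esum_(b in [set: C]) (K a b * f b)%:E + (g a)%:E)))%E.
Proof.
move=> f0 g0; have Kf0 a : (0 <= \esum_(b in [set: C]) (K a b * f b)%:E)%E.
  by apply: esum_ge0 => b _; rewrite lee_fin mulr_ge0.
rewrite chain_meanS// -esumD.
- by apply: eq_esum => a _; rewrite ge0_muleDr ?lee_fin.
- by move=> a _; rewrite mule_ge0.
- by move=> a _; rewrite mule_ge0 ?lee_fin.
Qed.

(** If one step lowers [f] in mean by at least [g], the drops telescope. They are added on the left,
    never subtracted, since the means may be infinite. *)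
Lemma chain_mean_superharmonic f g n :
  (forall a, 0 <= f a) -> (forall a, 0 <= g a) ->
  (forall a, \esum_(b in [set: C]) (K a b * f b)%:E + (g a)%:E <= (f a)%:E)%E ->
  (\sum_(0 <= m < n) chain_mean m g + chain_mean n f <= chain_mean 0 f)%E.
Proof.
move=> f0 g0 fg; elim: n => [|n]; first by rewrite big_geq// add0e.
apply: le_trans; rewrite big_nat_recr//= -addeA leeD2l//.
rewrite addeC chain_mean_drift//; apply: le_esum => a _.
by apply: lee_wpmul2l => //.
Qed.

Lemma chain_mean_harmonic f g n :
  (forall a, 0 <= f a) -> (forall a, 0 <= g a) ->
  (forall a, \esum_(b in [set: C]) (K a b * f b)%:E + (g a)%:E = (f a)%:E)%E ->
  (\sum_(0 <= m < n) chain_mean m g + chain_mean n f = chain_mean 0 f)%E.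
Proof.
move=> f0 g0 fg; elim: n => [|n <-]; first by rewrite big_geq// add0e.
rewrite big_nat_recr//= -addeA [X in (_ + X)%E]addeC chain_mean_drift//.
by congr (_ + _)%E; apply: eq_esum => a _; rewrite fg.
Qed.

End countable_markov_chain.

(** * One-step means of the walk *)

Lemma esum_point (R : realType) (I : choiceType) (i : I) (v : R) : 0 <= v ->
  (\esum_(j in [set: I]) (if j == i then v else 0)%:E = v%:E)%E.
Proof.
move=> v0; rewrite -[RHS](@esum_set1 _ _ i (fun=> v%:E)) ?lee_fin//.
rewrite [RHS]esum_mkcond; apply: eq_esum => j _.
have [->|ji] := eqVneq j i; first by rewrite mem_set.
by rewrite memNset// => /eqP; rewrite (negbTE ji).
Qed.

(** The four targets are distinct, so the nested tests amount to a sum of four point masses. *)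
Lemma esum_neighbours (R : realType) (i : int) (u v w z : R) (f : state -> R) :
  0 <= u -> 0 <= v -> 0 <= w -> 0 <= z -> (forall a, 0 <= f a) ->
  (\esum_(b in [set: state])
    ((match b with
      | inl j => if j == i + 1 then u else if j == i - 1 then v
                 else if j == i then w else 0
      | inr j => if j == i then z else 0
      end) * f b)%:E)%E =
  (u * f (inl (i + 1)) + v * f (inl (i - 1)) + w * f (inl i) +
   z * f (inr i))%:E.
Proof.
move=> u0 v0 w0 z0 f0.
pose pt (c : state) t (b : state) : R := if b == c then t * f c else 0.
have pt_ge0 c t b : 0 <= t -> (0 <= (pt c t b)%:E)%E.
  by move=> t0; rewrite lee_fin /pt; case: ifP => // _; rewrite mulr_ge0.
have sum_pt c t : 0 <= t ->
    (t * f c)%:E = (\esum_(b in [set: state]) (pt c t b)%:E)%E.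
  by move=> t0; rewrite esum_point ?mulr_ge0.
have ne1 : (i + 1 == i - 1 :> int) = false by lia.
have ne2 : (i + 1 == i :> int) = false by lia.
have ne3 : (i - 1 == i :> int) = false by lia.
rewrite !EFinD !sum_pt// -!esumD; try by move=> b _; rewrite ?adde_ge0// pt_ge0.
apply: eq_esum => -[j|j] _; rewrite -!EFinD /pt; congr (_%:E).
- rewrite !(inj_eq (@inl_inj _ _)) /= addr0.
  have [->|j1] := eqVneq j (i + 1); first by rewrite ne1 ne2 !addr0.
  have [->|j2] := eqVneq j (i - 1); first by rewrite ne3 addr0 add0r.
  by have [->|_] := eqVneq j i; rewrite ?mul0r ?addr0 ?add0r.
- rewrite !(inj_eq (@inr_inj _ _)) /= !add0r.
  by have [->|_] := eqVneq j i; rewrite ?mul0r.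
Qed.

Section mfb_kernel.
Context (R : realType) (N : nat) (p0 q0 r0 s0 p q : R).
Context (N_gt1 : (1 < N)%N)
  (p0_ge0 : 0 <= p0) (q0_ge0 : 0 <= q0) (r0_ge0 : 0 <= r0) (s0_ge0 : 0 <= s0)
  (sum_mfb : p0 + q0 + r0 + s0 = 1)
  (p_ge0 : 0 <= p) (q_ge0 : 0 <= q) (r_ge0 : 0 <= 1 - p - q).

Let K := step_prob N p0 q0 r0 s0 p q.

Lemma step_prob_ge0 a b : 0 <= K a b.
Proof.
case: a b => i [] j; rewrite /K /=.
- by have [_|_] := boolP (N%:Z %| i)%Z; case: eqP => // _; case: eqP => // _;
    case: eqP.
- by case: ifP.
- by [].
- by case: ifP.
Qed.

Lemma esum_step_inl i (f : state -> R) : (forall a, 0 <= f a) ->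
  (\esum_(b in [set: state]) (K (inl i) b * f b)%:E)%E =
  (if (N%:Z %| i)%Z
   then p0 * f (inl (i + 1)) + q0 * f (inl (i - 1)) + r0 * f (inl i) +
        s0 * f (inr i)
   else p * f (inl (i + 1)) + q * f (inl (i - 1)) + (1 - p - q) * f (inl i))%:E.
Proof.
move=> f0; have [Ni|Ni] := boolP (N%:Z %| i)%Z.
  rewrite -esum_neighbours//; apply: eq_esum => -[j|j] _.
    by rewrite /K /= Ni.
  by rewrite /K /= Ni.
(* A zero term at [inr i] brings in the four-target formula with absorption probability 0. *)
rewrite -[X in _ = X%:E]addr0 -(mul0r (f (inr i))).
rewrite -esum_neighbours//; apply: eq_esum => -[j|j] _.
  by rewrite /K /= (negbTE Ni).
by rewrite /K /= (negbTE Ni) if_same.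
Qed.

Lemma esum_step_inr i (f : state -> R) : (forall a, 0 <= f a) ->
  (\esum_(b in [set: state]) (K (inr i) b * f b)%:E)%E = (f (inr i))%:E.
Proof.
move=> f0; rewrite -(esum_point (inr i : state))//.
apply: eq_esum => -[j|j] _ /=; rewrite ?mul0r// !(inj_eq (@inr_inj _ _)).
by have [->|_] := eqVneq j i; rewrite ?mul1r ?mul0r.
Qed.

Definition alive : set state := range inl.

(** The probability that a live walker is absorbed at its next step. *)
Definition absorption_weight (a : state) : R :=
  if a is inl i then (if (N%:Z %| i)%Z then s0 else 0) else 0.

Let indic_inl i : \1_alive (inl i) = 1 :> R.
Proof. by rewrite indicE mem_set//; exists i. Qed.

Let indic_inr i : \1_alive (inr i) = 0 :> R.
Proof. by rewrite indicE memNset// => -[]. Qed.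

(** The mass leaving the live states in one step is exactly the mass absorbed; this is the equality
    needed by [chain_mean_harmonic]. *)
Lemma alive_step a :
  (\esum_(b in [set: state]) (K a b * \1_alive b)%:E +
   (absorption_weight a)%:E = (\1_alive a)%:E)%E.
Proof.
case: a => i; last by rewrite esum_step_inr// indic_inr adde0.
rewrite esum_step_inl// !indic_inl indic_inr /=.
case: ifP => _; rewrite -EFinD; congr (_%:E); rewrite !mulr1.
  by rewrite mulr0 addr0.
by rewrite addr0; lra.
Qed.

(** The type [state] has an absorbed state at every integer; those off the barriers have to be shown
    null. *)
Definition misabsorbed : set state :=
  [set a | exists2 i, a = inr i & ~~ (N%:Z %| i)%Z].

(** No step enters this set from outside and every [inr] is a trap, so its indicator is harmonic.
    The summand 0 fits the form of [chain_mean_harmonic]. *)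
Lemma misabsorbed_step a :
  (\esum_(b in [set: state]) (K a b * \1_misabsorbed b)%:E + 0%:E =
   (\1_misabsorbed a)%:E)%E.
Proof.
have out i : \1_misabsorbed (inl i) = 0 :> R.
  by rewrite indicE memNset// => -[].
rewrite adde0; case: a => i; last by rewrite esum_step_inr.
rewrite esum_step_inl// !out !mulr0 !addr0; case: ifP => // Ni.
by rewrite indicE memNset ?mulr0 ?addr0// => -[j [<-]]; rewrite Ni.
Qed.

(** * The drift potential *)

Context (s0_gt0 : 0 < s0) (q_gt0 : 0 < q).

Let residue_bound (i : int) : 0 <= (i %% N)%Z < N.
Proof. by rewrite modz_ge0 ?ltz_pmod//; lia. Qed.

Let residue_gt0 (i : int) : ~~ (N%:Z %| i)%Z -> 0 < (i %% N)%Z.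
Proof.
move=> Ni; have : (i %% N)%Z != 0 by apply: contra Ni => /eqP/dvdz_mod0P.
by have /andP[] := residue_bound i; lia.
Qed.

(** Off the barriers the residue is at least 1, so a step down does not wrap around. *)
Let residue_pred (i : int) :
  ~~ (N%:Z %| i)%Z -> ((i - 1) %% N)%Z = (i %% N)%Z - 1.
Proof.
move=> Ni; rewrite {1}(divz_eq i N) -addrA modzMDl modz_small//.
by have := residue_bound i; have := residue_gt0 Ni; lia.
Qed.

Let eta := q / 2.
(** Using the residue makes [W] periodic, hence bounded away from 0. *)
Let W (i : int) : R := eta ^+ `|(i %% N)%Z|%N.

Let eta_gt0 : 0 < eta. Proof. exact: divr_gt0. Qed.
Let eta_lt1 : eta < 1.
Proof. by move: p_ge0 q_gt0 r_ge0; rewrite /eta => *; lra. Qed.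

Let W_ge i : eta ^+ N <= W i.
Proof.
apply: ler_wiXn2l; rewrite ?ltW//.
by have := residue_bound i; lia.
Qed.

Let W_le1 i : W i <= 1.
Proof. by apply: exprn_ile1; rewrite ltW. Qed.

Let W_barrier i : (N%:Z %| i)%Z -> W i = 1.
Proof. by rewrite /W => /dvdz_mod0P ->. Qed.

Let W_pred i : ~~ (N%:Z %| i)%Z -> W i = eta * W (i - 1).
Proof.
move=> Ni; rewrite /W residue_pred// -exprS; congr (_ ^+ _).
by have := residue_gt0 Ni; lia.
Qed.

(** Equality holds unless [i + 1] is a barrier, where [W] returns to its maximum 1. *)
Let W_succ i : eta * W i <= W (i + 1).
Proof.
have [/W_barrier ->|Ni] := boolP (N%:Z %| (i + 1)%R)%Z.
  by rewrite mulr_ile1// ?exprn_ge0// ltW.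
by rewrite (W_pred Ni) addrK.
Qed.

Lemma drift_potential : exists (V : state -> R) (c : R),
  [/\ 0 < c, forall a, 0 <= V a &
   forall a, (\esum_(b in [set: state]) (K a b * V b)%:E +
              (c * \1_alive a)%:E <= (V a)%:E)%E].
Proof.
(* Off the barriers [W i = eta * W (i - 1)] is at least [eta ^+ N.+1], and the mean drop of the
   potential is at least half of [W i]. *)
pose c := eta ^+ N.+1 / 2.
have c_gt0 : 0 < c by rewrite divr_gt0 ?exprn_gt0.
(* On a barrier the potential is only [M - 1], so the loss [s0 * M] by absorption must cover 1 in
   addition to [c]. *)
pose M := (1 + c) / s0.
have Ms0 : s0 * M = 1 + c by rewrite /M mulrC divfK// gt_eqF.
have s0_le1 : s0 <= 1.
  by move: p0_ge0 q0_ge0 r0_ge0 sum_mfb => *; lra.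
have M1 : 1 <= M by rewrite /M ler_pdivlMr// mul1r; lra.
pose V (a : state) := if a is inl i then M - W i else 0.
have V_ge0 a : 0 <= V a.
  by case: a => //= i; have := W_le1 i; lra.
exists V, c; split => // -[] i; last first.
  by rewrite esum_step_inr// indic_inr mulr0 adde0.
rewrite esum_step_inl// indic_inl mulr1 -EFinD /V.
case: ifPn => Ni; rewrite lee_fin.
  (* The weights of the two neighbours only lower the mean, so their signs suffice. *)
  have wp : 0 <= p0 * W (i + 1) by rewrite mulr_ge0// exprn_ge0// ltW.
  have wm : 0 <= q0 * W (i - 1) by rewrite mulr_ge0// exprn_ge0// ltW.
  rewrite (W_barrier Ni) mulr0 addr0.
  have sumM : p0 * M + q0 * M + r0 * M + s0 * M = M.
    by rewrite -!mulrDl sum_mfb mul1r.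
  by move: r0_ge0 => ?; lra.
have := W_ge (i - 1); have := W_succ i.
rewrite (W_pred Ni); set w := W (i - 1); set w' := W (i + 1) => hp hm.
have cw : c <= eta * w / 2.
  by rewrite /c exprS; have := ler_wpM2l (ltW eta_gt0) hm; lra.
have pw : p * (eta * (eta * w)) <= p * w' by rewrite ler_wpM2l.
have w_gt0 : 0 < eta * w by rewrite mulr_gt0// exprn_gt0.
(* With q = 2 * eta and p <= 1 - q the drift is at least
   (1 - eta) * (2 - p) * eta * w, while c <= eta * w / 2. *)
have p_le : p <= 1 - 2 * eta by move: r_ge0; rewrite /eta => ?; lra.
have -> : q = 2 * eta by rewrite /eta; lra.
have : 1 / 2 * (eta * w) <= (1 - eta) * (2 - p) * (eta * w).
  rewrite ler_wpM2r ?ltW//; move: p_ge0 (eta_gt0) => ? ?.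
  have eta_le : 0 <= 1 / 2 - eta by lra.
  have p_le1 : 0 <= 1 - p by lra.
  by have := mulr_ge0 eta_le p_le1; lra.
have w'E : (1 - eta) * (2 - p) * (eta * w) =
  p * (eta * (eta * w)) - p * (eta * w) + 2 * eta * (w - eta * w) by ring.
by rewrite w'E; lra.
Qed.

End mfb_kernel.

(** * Almost sure absorption *)

Lemma exists_small_of_bounded_sums (R : realType) (u : nat -> \bar R) (c M e : R) :
  0 < c -> 0 < e ->
  (forall n, \sum_(0 <= m < n) (c%:E * u m) <= M%:E)%E ->
  exists n, (u n <= e%:E)%E.
Proof.
move=> c0 e0 bnd; apply: contrapT => /forallNP nex.
have gt n : (e%:E <= u n)%E by rewrite ltW// ltNge; apply/negP.
(* If every term exceeded [e], this many of them would sum past [M]. *)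
have [n ltn] : exists n : nat, M / (c * e) < n%:R.
  by exists (Num.truncn (M / (c * e))).+1; exact: truncnS_gt.
have := bnd n; apply/negP; rewrite -ltNge.
apply: (@lt_le_trans _ _ (\sum_(0 <= m < n) (c * e)%:E)%E).
  rewrite sumEFin lte_fin big_const_nat subn0 iter_addr_0.
  by rewrite -mulr_natl -ltr_pdivrMr// mulr_gt0.
by apply: lee_sum => m _; rewrite EFinM lee_pmul2l.
Qed.

(** The event of absorption and the series are treated separately. Both need, for each [e > 0], just
    one time at which survival has probability at most [e]. *)
Theorem theorem5 (R : realType) (N : nat) (p0 q0 r0 s0 p q : R) (i0 : int)
    (d : measure_display) (T : measurableType d) (P : probability T R)
    (X : nat -> T -> state)
    (N_gt1 : (1 < N)%N)
    (p0_ge0 : 0 <= p0) (q0_ge0 : 0 <= q0) (r0_ge0 : 0 <= r0) (s0_ge0 : 0 <= s0)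
    (sum_mfb : p0 + q0 + r0 + s0 = 1) (mfb_gt0 : 0 < p0 * q0 * s0)
    (p_ge0 : 0 <= p) (q_ge0 : 0 <= q)
    (r_ge0 : 0 <= 1 - p - q) (pq_gt0 : 0 < p * q)
    (i0_ge0 : 0 <= i0) (i0_ltN : i0 < N%:Z)
    (walkX : mfb_walk N p0 q0 r0 s0 p q i0 P X) :
  P (absorbed_in_mfb N X) = 1%E /\
  (\esum_(k in [set: int]) (s0%:E * expected_arrivals P X (k * N%:Z)) = 1)%E.
Proof.
have [mX X0 XK] := walkX.
have s0_gt0 : 0 < s0.
  by rewrite lt_neqAle s0_ge0 andbT eq_sym; apply: contraTneq mfb_gt0 => ->;
    rewrite mulr0 ltxx.
have q_gt0 : 0 < q.
  by rewrite lt_neqAle q_ge0 andbT eq_sym; apply: contraTneq pq_gt0 => ->;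
    rewrite mulr0 ltxx.
have K_ge0 := step_prob_ge0 N p0_ge0 q0_ge0 r0_ge0 s0_ge0 p_ge0 q_ge0 r_ge0.
pose E := chain_mean P X.
pose g := absorption_weight N s0.
have g_ge0 a : 0 <= g a by case: a => //= i; case: ifP.
have alive_ge0 a : 0 <= \1_alive a :> R by [].
have E0 f : (forall a, 0 <= f a) -> E 0%N f = (f (inl i0))%:E.
  exact: chain_mean0.
have harmonic := chain_mean_harmonic mX K_ge0 XK.
have aliveE n : (\sum_(0 <= m < n) E m g + E n \1_alive = 1)%E.
  rewrite harmonic//; last by move=> a; apply: alive_step.
  by rewrite -/E E0// indicE mem_set//; exists i0.
have alive_small (e : R) : 0 < e -> exists n, (E n \1_alive <= e%:E)%E.
  have [V [c [c0 V0 Vc]]] := drift_potential N_gt1 p0_ge0 q0_ge0 r0_ge0 s0_ge0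
    sum_mfb p_ge0 q_ge0 r_ge0 s0_gt0 q_gt0.
  move=> e0; apply: (@exists_small_of_bounded_sums _ _ c (V (inl i0)) _ c0 e0) => n.
  rewrite -(E0 V)//; have c1_ge0 a : 0 <= c * \1_alive a :> R by rewrite mulr_ge0// ltW.
  apply: le_trans (chain_mean_superharmonic mX K_ge0 XK n V0 c1_ge0 Vc).
  rewrite -[X in (X <= _)%E]adde0 leeD ?chain_mean_ge0//.
  by apply: lee_sum => m _; rewrite chain_meanZ// ltW.
split.
- have mA : measurable (absorbed_in_mfb N X).
    rewrite [X in measurable X](_ : _ =
      \bigcup_m (X m @^-1` [set a | exists k, a = inr (k * N%:Z)])).
      by apply: bigcupT_measurable => m; exact: preimage_countable_measurable.
    by apply/seteqP; split=> [w [m [k Xw]]|w [m _ [k Xw]]];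
      [exists m => //; exists k|exists m, k].
  apply/eqP; rewrite eq_le probability_le1//=.
  apply/lee_addgt0Pr => e /alive_small[n En].
  (* With drop 0 the mean of the indicator is constant in time, and it vanishes at time 0 because
     the start is a live state. *)
  have mis0 : P (X n @^-1` misabsorbed N) = 0%E.
    have mis_ge0 a : 0 <= \1_(misabsorbed N) a :> R by [].
    rewrite (chain_mean_indic P mX); apply/eqP; rewrite eq_le chain_mean_ge0// andbT.
    have : E 0%N \1_(misabsorbed N) = 0%E.
      by rewrite E0// indicE memNset// => -[].
    rewrite /E -(harmonic _ (fun=> 0) n)//; last first.
      by move=> a; apply: misabsorbed_step.
    by move=> <-; rewrite leeDr// sume_ge0// => m _; exact: chain_mean_ge0.
  have malive D : measurable (X n @^-1` D).
    exact: preimage_countable_measurable.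
  (* Outside the absorption event the walker is at time [n] either alive, with probability at most
     [e], or in the null set [misabsorbed N]. *)
  have cover : setT `<=` absorbed_in_mfb N X `|`
      (X n @^-1` alive `|` X n @^-1` misabsorbed N).
    move=> w _; case Xw: (X n w) => [i|i].
      by right; left; rewrite /= Xw; exists i.
    have [/dvdzP[k ik]|Ni] := boolP (N%:Z %| i)%Z.
      by left; exists n, k; rewrite Xw ik.
    by right; right; rewrite /= Xw; exists i.
  rewrite -(@probability_setT _ _ _ P).
  apply: (@le_trans _ _ (P (absorbed_in_mfb N X `|`
      (X n @^-1` alive `|` X n @^-1` misabsorbed N)))).
    by apply: le_measure => //; rewrite inE//; do ?apply: measurableU.
  apply: (@le_trans _ _ (P (absorbed_in_mfb N X) +
      (P (X n @^-1` alive) + P (X n @^-1` misabsorbed N)))%E).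
    apply: le_trans (measureU2 P mA (measurableU _ _ (malive _) (malive _))) _.
    by rewrite leeD2l//; exact: measureU2.
  by rewrite mis0 adde0 (chain_mean_indic P mX) leeD2l.
- pose u (k : int) m : \bar R := (s0%:E * P (X m @^-1` [set inl (k * N%:Z)%R]))%E.
  have u_ge0 k m : (0 <= u k m)%E by rewrite mule_ge0// lee_fin.
  (* Regrouping by barriers: the map [e] is injective since [N] is nonzero, and states outside its
     image have weight 0. *)
  have EgE m : E m g = (\esum_(k in [set: int]) u k m)%E.
    pose e (k : int) : state := inl (k * N%:Z).
    have e_inj : set_inj setT e.
      move=> k l _ _ [] /mulIf; apply.
      by rewrite eqz_nat -lt0n ltnW.
    rewrite -(@esum_image _ _ _ setT e
      (fun a => s0%:E * P (X m @^-1` [set a]))%E)//.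
    rewrite [RHS]esum_mkcond; apply: eq_esum => -[i|i] _; last first.
      by rewrite mule0 memNset// => -[].
    rewrite /g /=; have [/dvdzP[k ->]|Ni] := boolP (N%:Z %| i)%Z.
      by rewrite mem_set 1?muleC//; exists k.
    rewrite mule0 memNset// => -[k _ [ki]].
    by move: Ni; rewrite -ki dvdz_mull.
  rewrite (eq_esum (b := fun k => \esum_(m in [set: nat]) u k m)%E); last first.
    by move=> k _; rewrite -nneseries_esumT// nneseriesZl.
  (* By Tonelli the sum over barriers is taken first, which leaves the sum over time of the
     absorption probabilities [E m g]. *)
  rewrite exchange_esum// (eq_esum (b := fun m => E m g)); last first.
    by move=> m _; rewrite EgE.
  have Eg_ge0 m : (0 <= E m g)%E by exact: chain_mean_ge0.
  (* The partial sums never exceed 1 by [aliveE], and by [alive_small] they come within any [e] of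
     it. *)
  rewrite -nneseries_esumT//; apply/eqP; rewrite eq_le; apply/andP; split.
    apply: lime_le; first exact: is_cvg_nneseries.
    near=> n; rewrite -(aliveE n) leeDl//; exact: chain_mean_ge0.
  apply/lee_addgt0Pr => e /alive_small[n En].
  by rewrite -(aliveE n) leeD// nneseries_lim_ge.
Unshelve. all: by end_near.
Qed.
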